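(* Let $\mathcal{X}$ be a discrete function space on a tree $T$. The differentiation operator $D$ is bounded on $\mathcal{X}$ if and only if $D$ maps $\mathcal{X}$ into $\mathcal{X}$.
   Context: A tree $T$ is a locally finite, connected, simply-connected graph, identified with its set of vertices. A vertex is terminal if it has a unique neighbor; all trees are assumed to be without terminal vertices (hence infinite) and rooted at a vertex $o$. For $v\neq o$, $v^-$ denotes the unique neighbor of $v$ lying on the path from $o$ to $v$ (the parent of $v$). A function on $T$ is a complex-valued function on its vertices. The derivative of $f:T\to\mathbb{C}$ is $f'(v)=f(v)-f(v^-)$ for $v\neq o$ and $f'(o)=0$. A functional Banach space on a set $\Omega$ is a Banach space of complex-valued functions on $\Omega$ with pointwise vector operations, such that $f(x)=g(x)$ for all $x\in\Omega$ implies $f=g$, $f(x)=f(y)$ for every $f$ in the space implies $x=y$, and for each $x\in\Omega$ the linear functional $f\mapsto f(x)$ is continuous. A discrete function space $\mathcal{X}$ on $T$ is a functional Banach space whose elements are functions on $T$, with norm $\|\cdot\|_{\mathcal{X}}$. The differentiation operator is $Df=f'$. ''$D$ is bounded on $\mathcal{X}$'' means $D$ is a bounded linear operator from $\mathcal{X}$ to $\mathcal{X}$. *)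

(* Defs.v *)
From HB Require Import structures.
From mathcomp Require Import all_boot all_order all_algebra.
From mathcomp Require Import complex.
From mathcomp Require Import all_classical all_reals all_analysis.

Set Implicit Arguments.
Unset Strict Implicit.
Unset Printing Implicit Defensive.

Import Order.TTheory GRing.Theory Num.Theory numFieldNormedType.Exports.

Local Open Scope classical_set_scope.
Local Open Scope ring_scope.
Local Open Scope complex_scope.

(* A vertex is terminal if it has exactly one neighbor. [rt_infinite] only
   excludes the one-vertex graph, which has no terminal vertex in this sense;
   for all larger trees it follows from [rt_no_terminal]. *)
Record rooted_tree := RootedTree {
  vertex :> choiceType ;
  adj : rel vertex ;
  root : vertex ;
  rt_sym : symmetric adj ;
  rt_irr : irreflexive adj ;
  rt_locally_finite : forall v, finite_set [set w | adj v w] ;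
  rt_connected : forall v w, exists p, path adj v p /\ last v p = w ;
  rt_acyclic : forall c : seq vertex, (2 < size c)%N -> ~ ucycle adj c ;
  rt_no_terminal : forall v, ~ (exists! w, adj v w) ;
  rt_infinite : infinite_set [set: vertex] }.

Arguments root {r}.

Section Tree.
Variable T : rooted_tree.

(* [v :: p] is the sequence of vertices of a simple path from [v] to [w]. *)
Definition simple_path (v w : T) (p : seq T) : Prop :=
  [/\ path (@adj T) v p, last v p = w & uniq (v :: p)].

(* Since [T] is a tree, exactly one vertex qualifies when [v != root]; the
   value at [root] is a dummy. *)
Definition parent (v : T) : T :=
  xget root [set w | adj v w /\
    exists p, simple_path root v p /\ w \in root :: p].

Definition derivative (R : realType) (f : T -> R[i]) : T -> R[i] :=
  fun v => if v == root then 0 else f v - f (parent v).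

End Tree.

(* A Banach space of functions on [Omega] is given as an abstract complex Banach
   space together with the linear (pointwise operations) injection [fbs_fun]
   sending each element to the function it is. [R[i]^o] is the field of complex
   numbers with the topology of its modulus. *)
Record functional_banach_space (R : realType) (Omega : Type) :=
  FunctionalBanachSpace {
  fbs_sort :> completeNormedModType R[i] ;
  fbs_fun : fbs_sort -> Omega -> R[i] ;
  fbs_linear : forall (a : R[i]) (f g : fbs_sort) (x : Omega),
    fbs_fun (a *: f + g) x = a * fbs_fun f x + fbs_fun g x ;
  fbs_ext : forall f g : fbs_sort,
    (forall x, fbs_fun f x = fbs_fun g x) -> f = g ;
  fbs_separates : forall x y : Omega,
    (forall f : fbs_sort, fbs_fun f x = fbs_fun f y) -> x = y ;
  fbs_continuous_eval : forall x : Omega,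
    continuous (fun f : fbs_sort => fbs_fun f x : R[i]^o) }.

Definition discrete_function_space (R : realType) (T : rooted_tree) :=
  functional_banach_space R T.

Section Operators.
Variables (R : realType) (Omega : Type).
Variable S : (Omega -> R[i]) -> (Omega -> R[i]).
Variable X : functional_banach_space R Omega.

Definition maps_into_itself : Prop :=
  forall f : X, exists g : X, fbs_fun g = S (fbs_fun f).

(* The norm of [X] takes its values in the nonnegative reals inside [R[i]],
   hence the injection [M%:C] of the real constant [M]. *)
Definition bounded_operator_on : Prop :=
  exists L : {linear X -> X},
    (forall f : X, fbs_fun (L f) = S (fbs_fun f)) /\
    (exists M : R, forall f : X, `|L f| <= M%:C * `|f|).

End Operators.

(* Main.v *)
From HB Require Import structures.
Require Import Defs.
From mathcomp Require Import all_boot all_order all_algebra.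
From mathcomp Require Import complex.
From mathcomp Require Import all_classical all_reals all_analysis.

(** Only the implication from invariance to boundedness has content, and it is
    an instance of the closed graph theorem. If [D] maps the space [X] into
    itself, it is a linear map [X -> X]. Its graph is the set of the pairs
    [(f, g)] such that [g v = f v - f v^-] at each vertex [v] other than the
    root, and [g v = 0] at the root. Evaluations at vertices are continuous on
    [X], so each of these conditions is closed in [X * X]; hence the graph is
    closed and [D] is bounded.

    The scalars here are complex, with norms valued in the nonnegative reals
    inside [R[i]]. The closed graph theorem ([closed_graph]) is proved over any
    archimedean [numFieldType], where positive elements are pairwise comparable
    even though the order is partial. Its proof follows Zabreiko. For a linear
    [f] the sets [{x : |f x| <= n}] cover the domain, so by Baire's argument
    ([baire_cover]) one of them is dense in some ball. By differences and
    scaling, every [x] of norm less than [r / 2^k] is then within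
    [r / 2^(k+1)] of a point whose image has norm at most [M / 2^k]. Iterating,
    [x] is the sum of a series whose images form a series of norm at most
    [2 * M]; closedness of the graph identifies the sum of the latter with
    [f x]. So [f] is bounded on the ball of radius [r]. Both the Baire argument
    and the convergence of the series of images rest on the completeness
    statement [cvg_nested_balls]. *)

Set Implicit Arguments.
Unset Strict Implicit.
Unset Printing Implicit Defensive.

Import Order.TTheory GRing.Theory Num.Theory numFieldNormedType.Exports.

Local Open Scope classical_set_scope.
Local Open Scope ring_scope.

Lemma exp_half_lt (K : numFieldType) (archiK : Num.archimedean_axiom K)
    (e : K) :
  0 < e -> exists n, 2^-1 ^+ n < e.
Proof.
move=> e0; have [n en] := archiK e^-1; exists n.
rewrite exprVn invf_plt ?posrE ?exprn_gt0//.
rewrite gtr0_norm ?invr_gt0// in en.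
by rewrite (lt_le_trans en)// -natrX ler_nat ltnW// ltn_expl.
Qed.

Lemma pos_lower_bound (K : numFieldType) (a b : K) : 0 < a -> 0 < b ->
  exists c, [/\ 0 < c, c <= a & c <= b].
Proof.
move=> a0 b0; have ab : a >=< b by rewrite real_comparable// gtr0_real.
exists (Num.min a b).
by rewrite comparable_lt_min// a0 b0 !comparable_ge_min// !lexx orbT.
Qed.

(** The second hypothesis says that the closed balls [B(u n, r n)] are nested,
    in the form that the triangle inequality propagates. It covers both the
    shrinking balls of a Baire argument and the partial sums of a series, with
    [r n] a bound on the sum of the norms of the remaining terms. *)
Lemma cvg_nested_balls (K : numFieldType) (U : completeNormedModType K)
    (u : nat -> U) (r : nat -> K) :
    (forall n, 0 <= r n) -> (forall n, `|u n - u n.+1| + r n.+1 <= r n) ->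
    (forall e, 0 < e -> exists n, r n < e) ->
  exists2 l, u @ \oo --> l & forall n, `|u n - l| <= r n.
Proof.
move=> r0 ur rcvg.
have nested n k : `|u n - u (n + k)%N| + r (n + k)%N <= r n.
  elim: k => [|k IH]; first by rewrite addn0 subrr normr0 add0r.
  rewrite addnS; apply: le_trans IH; have := ur (n + k)%N.
  rewrite -(lerD2l `|u n - u (n + k)%N|); apply: le_trans.
  by rewrite addrA lerD2r ler_distD.
have tail n m : (n <= m)%N -> `|u n - u m| <= r n.
  by move=> /subnKC <-; apply: le_trans (nested n (m - n)%N); rewrite lerDl.
have /cauchy_cvg/cvg_ex[l ul] : cauchy (u @ \oo).
  apply: cauchy_exP => e e0; have [n rn] := rcvg e e0.
  exists (u n); rewrite /fmapE -ball_normE; exists n => // m /= nm.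
  exact: le_lt_trans (tail _ _ nm) rn.
exists l => // n; apply/ler_addgt0Pr => e e0.
have [N _ Nl] := (cvgrPdist_lt _ _).1 ul e e0.
have lm : `|l - u (maxn n N)| < e by apply: Nl; rewrite /= leq_maxr.
rewrite (le_trans (ler_distD (u (maxn n N)) _ _))// lerD ?tail ?leq_maxl//.
by rewrite distrC ltW.
Qed.

(** If every [A n] were nowhere dense, each ball would contain a smaller closed
    ball that misses [A n]. Shrinking in this way for [n = 0, 1, ...] gives
    nested balls whose common point lies in no [A n]. *)
Lemma baire_cover (K : numFieldType) (archiK : Num.archimedean_axiom K)
    (U : completeNormedModType K) (A : nat -> set U) :
    (forall x, exists n, A n x) ->
  exists n x r, 0 < r /\ ball x r `<=` closure (A n).
Proof.
move=> Acover; apply: contrapT => nA.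
have shrink (p : nat * (U * K)) : exists q : U * K, 0 < p.2.2 ->
    [/\ 0 < q.2, `|p.2.1 - q.1| + q.2 <= p.2.2, q.2 <= p.2.2 / 2 &
       forall z, `|q.1 - z| <= q.2 -> ~ A p.1 z].
  case: p => n [x r]; have [r0|] := pselect (0 < r); last by exists (x, r).
  have : ~ ball x r `<=` closure (A n) by move=> xr; apply: nA; exists n, x, r.
  move=> /existsNP[y /not_implyP[]]; rewrite -ball_normE/= => xy.
  move=> /existsNP[S /not_implyP[/nbhs_ballP[e /= e0 yS] AS]].
  (* A radius at most [e / 2] keeps the closed ball inside the open [ball y e];
     half the room left in [ball x r] also gives [c <= r / 2]. *)
  have [c [c0 ce crxy]] :
      exists c, [/\ 0 < c, c <= e / 2 & c <= (r - `|x - y|) / 2].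
    by apply: pos_lower_bound; rewrite divr_gt0 ?subr_gt0.
  exists (y, c) => _ /=; split => //.
  - rewrite -lerBrDl (le_trans crxy)// ler_pdivrMr// ler_peMr ?ler1n//.
    by rewrite subr_ge0 ltW.
  - by rewrite (le_trans crxy)// ler_pM2r ?invr_gt0// gerBl.
  - move=> z yz Az; apply: AS; exists z; split=> //; apply: yS.
    rewrite -ball_normE /= (le_lt_trans yz)// (le_lt_trans ce)//.
    by rewrite ltr_pdivrMr// ltr_pMr// ltr1n.
have [g gP] := choice shrink.
pose fix p n := if n is m.+1 then g (m, p m) else (0 : U, 1 : K).
have p0 n : 0 < (p n).2.
  by elim: n => [|n IH] //=; have [] := gP (n, p n) IH.
have pS n := gP (n, p n) (p0 n).
have phalf n : (p n).2 <= 2^-1 ^+ n.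
  elim: n => [|n IH]; first by rewrite expr0.
  rewrite exprSr; have [_ _ + _] := pS n; move/le_trans; apply.
  by rewrite ler_pM2r ?invr_gt0.
have [| | |l _ pl] :=
    @cvg_nested_balls K U (fun n => (p n).1) (fun n => (p n).2).
- by move=> n; exact: ltW.
- by move=> n; have [_ ? _ _] := pS n.
- by move=> e /(exp_half_lt archiK)[n ne]; exists n; exact: le_lt_trans ne.
have [n An] := Acover l.
(* The ball of index [n.+1] is the one chosen to miss [A n]. *)
by have [_ _ _ /(_ l (pl n.+1))] := pS n.
Qed.

(** The bound on a ball comes from writing each point of it as the sum of a
    series with geometrically decreasing images, where closedness of the graph
    allows [f] to be applied term by term. *)
Theorem closed_graph (K : numFieldType) (archiK : Num.archimedean_axiom K)
    (U V : completeNormedModType K) (f : {linear U -> V}) :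
  closed [set p : U * V | f p.1 = p.2] -> continuous f.
Proof.
move=> fclosed.
have [x|n [x0 [r [r0 dense_r]]]] :=
  @baire_cover K archiK U (fun n => [set x | `|f x| <= n%:R]).
  have [n fx] := archiK `|f x|; exists n.
  by rewrite normr_id in fx; exact: ltW.
(* [n + n] bounds the image of a difference of two points of the dense set; the
   successor makes [M] positive, so that one can divide by it. *)
pose M : K := (n + n).+1%:R.
have M0 : 0 < M by rewrite ltr0n.
(* Density around [x0] is moved to the origin by writing [x] as the difference
   of [x0 + x] and [x0], both approximated within [r / 4]. *)
have approx1 x : `|x| < r -> exists a, `|f a| <= M /\ `|x - a| < r / 2.
  move=> xr; have near_pt z : `|x0 - z| < r ->
      exists a, `|f a| <= n%:R /\ `|z - a| < r / 2 / 2.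
    move=> zr; have := dense_r z; rewrite -ball_normE => /(_ zr).
    case/(_ (ball z (r / 2 / 2))).
      by apply: nbhsx_ballx; rewrite !divr_gt0.
    by rewrite -ball_normE => a [fa az]; exists a.
  have [|a [fa xa]] := near_pt (x0 + x); first by rewrite opprD addNKr normrN.
  have [|b [fb xb]] := near_pt x0; first by rewrite subrr normr0.
  exists (a - b); split.
    rewrite linearB (le_trans (ler_normB _ _))// (le_trans (lerD fa fb))//.
    by rewrite -natrD ler_nat.
  rewrite (_ : x - _ = (x0 + x - a) - (x0 - b)); last first.
    by rewrite !opprB ![b - _]addrC addrACA [x0 + x]addrC addrK.
  rewrite (le_lt_trans (ler_normB _ _))// (lt_le_trans (ltrD xa xb))//.
  by rewrite -splitr.
have approx (p : nat * U) : exists a, `|p.2| < 2^-1 ^+ p.1 * r ->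
    `|f a| <= 2^-1 ^+ p.1 * M /\ `|p.2 - a| < 2^-1 ^+ p.1.+1 * r.
  case: p => k x /=.
  have h0 : 0 < 2^-1 ^+ k :> K by rewrite exprn_gt0 ?invr_gt0.
  have [xr|] := pselect (`|x| < 2^-1 ^+ k * r); last by exists 0.
  have [|a [fa xa]] := approx1 ((2^-1 ^+ k)^-1 *: x).
    by rewrite normrZ gtr0_norm ?invr_gt0// ltr_pdivrMl.
  exists (2^-1 ^+ k *: a) => _; split.
    by rewrite linearZ/= normrZ gtr0_norm// ler_pM2l.
  rewrite (_ : x - _ = 2^-1 ^+ k *: ((2^-1 ^+ k)^-1 *: x - a)); last first.
    by rewrite scalerBr scalerA divff ?lt0r_neq0// scale1r.
  rewrite normrZ gtr0_norm// exprSr -mulrA ltr_pM2l//.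
  by rewrite mulrC.
have [g gP] := choice approx.
suff bound x : `|x| < r -> `|f x| <= 2 * M.
  apply: bounded_linear_continuous; apply/ex_bound; exists (2 * M).
  apply/nbhs_ballP; exists r => //= z.
  by rewrite -ball_normE/= sub0r normrN => /bound.
move=> xr.
(* [y k] is the remainder of [x] after [k] approximations, so [x - y k] is the
   [k]-th partial sum. *)
pose fix y n := if n is m.+1 then y m - g (m, y m) else x.
have yr k : `|y k| < 2^-1 ^+ k * r.
  elim: k => [|k IH]; first by rewrite mul1r.
  by have [] := gP (k, y k) IH.
have fg k := (gP (k, y k) (yr k)).1.
have [| | |l fl lbound] :=
    @cvg_nested_balls K V (fun k => f (x - y k)) (fun k => 2^-1 ^+ k * (2 * M)).
- by move=> k; rewrite mulr_ge0 ?exprn_ge0 ?invr_ge0 ?mulr_ge0// ltW.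
- move=> k; rewrite -linearB /= opprD addrACA subrr add0r opprK.
  rewrite (_ : - y k + _ = - g (k, y k)); last by rewrite addKr.
  rewrite linearN normrN (le_trans (lerD (fg k) (lexx _)))//.
  by rewrite exprSr -(mulrA _ 2^-1) mulKf ?pnatr_eq0// mulrCA mulr_natl mulr2n.
- move=> e e0; have [|k ke] := @exp_half_lt K archiK (e / (2 * M)).
    by rewrite divr_gt0 ?mulr_gt0.
  by exists k; rewrite -ltr_pdivlMr ?mulr_gt0.
have ux : (fun k => x - y k) @ \oo --> x.
  apply/cvgrPdist_lt => e e0; have [|k ke] := @exp_half_lt K archiK (e / r).
    by rewrite divr_gt0.
  exists k => // m /= km; rewrite opprB addrC subrK.
  rewrite (lt_trans (yr m))// -ltr_pdivlMr// (le_lt_trans _ ke)//.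
  by rewrite ler_wiXn2l ?invr_ge0 ?invf_le1 ?ler1n.
have fxl : f x = l.
  apply: (@closed_cvg _ _ \oo _ (fun k => (x - y k, f (x - y k))) _
    fclosed _ (x, l)).
    exact: nearW.
  exact: cvg_pair.
(* The partial sum of index [0] is [0], so its distance to [l] is [`|l|]. *)
have := lbound 0%N; rewrite /= subrr linear0 sub0r normrN mul1r.
by rewrite fxl.
Qed.

Lemma complex_archimedean (R : realType) : Num.archimedean_axiom R[i].
Proof.
move=> x; have /complex_realP[k ->] := normr_real x.
exists (Num.truncn k).+1; rewrite -(rmorph_nat (real_complex R)) ltcR.
exact: truncnS_gt.
Qed.

(** The two hypotheses make [S] linear with a closed graph: [(f, g)] lies in it if
    and only if [g x = S f x] for every [x], and both sides are continuous in
    the pair. The case [S f = f \o phi] covers composition operators, and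
    [S f = m * f] multiplication operators. *)
Lemma bounded_operator_iff_maps_into_itself (R : realType) (Omega : Type)
    (S : (Omega -> R[i]) -> Omega -> R[i])
    (X : functional_banach_space R Omega) :
    (forall (a : R[i]) (f g : Omega -> R[i]) x,
      S (fun y => a * f y + g y) x = a * S f x + S g x) ->
    (forall x, continuous (fun f : X => S (fbs_fun f) x : R[i]^o)) ->
  bounded_operator_on S X <-> maps_into_itself S X.
Proof.
move=> Slin Scont; split=> [[L [LS _]] f|/choice[D DS]]; first by exists (L f).
have Dlin : linear D.
  move=> a f g; apply: fbs_ext => x; rewrite fbs_linear !DS -Slin.
  by congr (S _ x); apply/funext => y; rewrite fbs_linear.
pose L : {linear X -> X} := HB.pack D (GRing.isLinear.Build _ _ _ _ D Dlin).
exists L; split=> [f|]; first exact: DS.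
have Lclosed : closed [set p : X * X | L p.1 = p.2].
  pose gap x (p : X * X) : R[i]^o := fbs_fun p.2 x - S (fbs_fun p.1) x.
  rewrite (_ : mkset _ = \bigcap_x (gap x @^-1` [set 0])).
    apply: closed_bigI => x _; apply: preimage_closed; last first.
      exact/accessible_closed_set1/hausdorff_accessible/norm_hausdorff.
    move=> p _; apply: continuousB.
      apply: (@continuous_comp _ _ _ snd (fun f : X => fbs_fun f x : R[i]^o)).
        exact: cvg_snd.
      exact: fbs_continuous_eval.
    apply: (@continuous_comp _ _ _ fst
      (fun f : X => S (fbs_fun f) x : R[i]^o)); first exact: cvg_fst.
    exact: Scont.
  apply/seteqP; split => -[f g] /=.
    by move=> <- x _ /=; rewrite /gap DS subrr.
  move=> fg; apply: fbs_ext => x; rewrite DS; apply/esym/eqP.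
  by rewrite -subr_eq0; apply/eqP/fg.
have := closed_graph (@complex_archimedean R) Lclosed.
move=> /linear_bounded_continuous/linear_boundedP/pinfty_ex_gt0[M M0 LM].
(* [M] is a positive element of [R[i]], hence the image of a real number. *)
have /complex_realP[m Mm] := gtr0_real M0.
by exists m => f; rewrite -Mm; exact: LM.
Qed.

Theorem theorem2p6 (R : realType) (T : rooted_tree)
    (X : discrete_function_space R T) :
  bounded_operator_on (@derivative T R) X <->
  maps_into_itself (@derivative T R) X.
Proof.
apply: bounded_operator_iff_maps_into_itself => [a f g v|v]; rewrite /derivative.
  case: (v == Defs.root); first by rewrite mulr0 addr0.
  by rewrite opprD addrACA mulrBr.
case: (v == Defs.root); first exact: cst_continuous.
by move=> f; apply: continuousB; exact: fbs_continuous_eval.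
Qed.
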